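(* Let $b_1>1$ and $c>0$. If $(z_0,t_0,0)$ and $(z_1,t_1,0)$ are the two distinct intersection points of a Hugoniot curve with the characteristic surface $\mathcal{C}=\{Y=0\}$, then one of them lies on $\mathcal{C}_s=\{Y=0,\ t<0\}$ and the other lies on $\mathcal{C}_f=\{Y=0,\ t>0\}$. Furthermore, the value of the speed $s$ at the point on $\mathcal{C}_s$ is always smaller than the value of $s$ at the point on $\mathcal{C}_f$.
   Context: Fix reals $b_1>1$, $a_1,a_2,a_3,a_4$ with $c=a_3-a_2>0$. Consider the flux $F=(f,g)$, $f(u,v)=\frac{v^2}{2}+\frac{(b_1+1)u^2}{2}+a_1u+a_2v$, $g(u,v)=uv+a_3u+a_4v$, and the Rankine-Hugoniot relation $F(u,v)-F(u',v')=s\,(u-u',v-v')$. Put $U=\frac{u+u'}{2}$, $V=\frac{v+v'}{2}$, $X=u-u'$, $Y=v-v'$, $X=zY$, $\widetilde U=b_1U+a_1-a_4$, $V_1=V+a_3$. After blowing up the diagonal, the wave manifold $\mathcal{W}$ is given (away from the plane $\Pi=\{z=\infty\}$) by $(z^2-1)V_1-z\widetilde U+c=0$, $X=zY$, and $\mathcal{W}-\Pi$ is identified with $\mathbb{R}^3$ with coordinates $(z,t,Y)$ through $$\widetilde U=\frac{2cz}{z^2+1}+ct(z^2-1),\qquad V_1=\frac{c}{z^2+1}+ctz .$$ A Hugoniot curve is a set of the form $\{u=u_0,\ v=v_0\}$ ($u_0,v_0$ constants) in $\mathcal{W}-\Pi$; equivalently, a set of points $(z,t,Y)\in\mathbb{R}^3$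 on which both $\widetilde U+\frac{b_1}{2}zY$ and $V_1+\frac12Y$ take given constant values. The shock speed (normalized up to an additive constant depending only on $b_1,a_1,a_4$) is the function on $\mathcal{W}-\Pi$ $$s=\frac{\widetilde U}{b_1}+zV_1=\frac{c\left[(b_1+1)tz^4+b_1tz^2+(b_1+2)z-t\right]}{b_1(z^2+1)} .$$ *)

(* Defs.v *)
From Stdlib Require Import Reals Lra Psatz.
Open Scope R_scope.

Record params := Params { b1 : R; a1 : R; a2 : R; a3 : R; a4 : R }.

Definition c (P : params) : R := a3 P - a2 P.

Definition flux (P : params) (q : R * R) : R * R :=
  let (u, v) := q in
  (v ^ 2 / 2 + (b1 P + 1) * u ^ 2 / 2 + a1 P * u + a2 P * v,
   u * v + a3 P * u + a4 P * v).

Definition rankine_hugoniot (P : params) (s : R) (q q' : R * R) : Prop :=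
  fst (flux P q) - fst (flux P q') = s * (fst q - fst q') /\
  snd (flux P q) - snd (flux P q') = s * (snd q - snd q').

(* A pair of states (u, v), (u', v') together with the finite slope z for
   which X = z Y; z is an independent coordinate on the diagonal X = Y = 0. *)
Record wave_point :=
  WavePoint { wz : R; wu : R; wv : R; wu' : R; wv' : R }.

Definition wU (w : wave_point) : R := (wu w + wu' w) / 2.
Definition wV (w : wave_point) : R := (wv w + wv' w) / 2.
Definition wX (w : wave_point) : R := wu w - wu' w.
Definition wY (w : wave_point) : R := wv w - wv' w.
Definition wUt (P : params) (w : wave_point) : R :=
  b1 P * wU w + a1 P - a4 P.
Definition wV1 (P : params) (w : wave_point) : R := wV w + a3 P.

(* The wave manifold with the plane z = infinity removed. *)
Definition wave_manifold (P : params) (w : wave_point) : Prop :=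
  (wz w ^ 2 - 1) * wV1 P w - wz w * wUt P w + c P = 0 /\
  wX w = wz w * wY w.

Definition Ut (P : params) (z t : R) : R :=
  2 * c P * z / (z ^ 2 + 1) + c P * t * (z ^ 2 - 1).
Definition V1 (P : params) (z t : R) : R :=
  c P / (z ^ 2 + 1) + c P * t * z.

(* The inverse of the coordinate system (z, t, Y): R^3 is mapped bijectively
   onto [wave_manifold], see the lemmas below. *)
Definition chart (P : params) (p : R * R * R) : wave_point :=
  let '(z, t, Y) := p in
  let U := (Ut P z t - a1 P + a4 P) / b1 P in
  let V := V1 P z t - a3 P in
  WavePoint z (U + z * Y / 2) (V + Y / 2) (U - z * Y / 2) (V - Y / 2).

Definition hugoniot_curve (P : params) (u0 v0 : R) (p : R * R * R) : Prop :=
  wu (chart P p) = u0 /\ wv (chart P p) = v0.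

Definition char_surface (p : R * R * R) : Prop :=
  let '(_, _, Y) := p in Y = 0.
Definition char_slow (p : R * R * R) : Prop :=
  let '(_, t, Y) := p in Y = 0 /\ t < 0.
Definition char_fast (p : R * R * R) : Prop :=
  let '(_, t, Y) := p in Y = 0 /\ t > 0.

(* Normalized: the speed in the Rankine-Hugoniot relation is this function
   plus a constant, see [shock_speed_rankine_hugoniot]. *)
Definition shock_speed (P : params) (p : R * R * R) : R :=
  let '(z, t, _) := p in Ut P z t / b1 P + z * V1 P z t.

Lemma wave_manifold_off_diagonal (P : params) (w : wave_point) :
  wX w = wz w * wY w -> wY w <> 0 ->
  (wave_manifold P w <->
   exists s, rankine_hugoniot P s (wu w, wv w) (wu' w, wv' w)).
Proof.
destruct w as [z u v u' v'], P as [b d1 d2 d3 d4].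
unfold wave_manifold, rankine_hugoniot, wUt, wV1, wU, wV, wX, wY, c; simpl.
intros HX HY.
assert (Hu : u = u' + z * (v - v')) by lra.
subst u; clear HX; split.
- intros [H _].
  exists ((u' + z * (v - v') + u') / 2 + z * ((v + v') / 2 + d3) + d4).
  split; [|field].
  apply Rminus_diag_uniq.
  match goal with |- ?l = 0 => match type of H with ?h = 0 =>
    replace l with ((v' - v) * h) by field end end.
  rewrite H; ring.
- intros [s [H1 H2]]; split; [|ring].
  assert (Hs : s = (u' + z * (v - v') + u') / 2
                   + z * ((v + v') / 2 + d3) + d4).
  { apply (Rmult_eq_reg_r (v - v')); [|exact HY]. rewrite <- H2; field. }
  rewrite Hs in H1.
  apply (Rmult_eq_reg_r (v' - v)); [|lra].
  apply Rminus_diag_eq in H1. rewrite Rmult_0_l, <- H1; field.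
Qed.

Lemma chart_wave_manifold (P : params) (p : R * R * R) :
  b1 P <> 0 -> wave_manifold P (chart P p).
Proof.
destruct p as [[z t] Y]; intros Hb.
unfold wave_manifold, wUt, wV1, wU, wV, wX, wY, chart, Ut, V1; simpl.
split; field; try split; nra.
Qed.

Lemma chart_coordinates (P : params) (z t Y : R) :
  b1 P <> 0 ->
  wUt P (chart P (z, t, Y)) = Ut P z t /\
  wV1 P (chart P (z, t, Y)) = V1 P z t /\
  wX (chart P (z, t, Y)) = z * Y /\
  wY (chart P (z, t, Y)) = Y.
Proof.
intros Hb.
unfold wUt, wV1, wU, wV, wX, wY, chart; simpl.
repeat split; field; exact Hb.
Qed.

Lemma chart_bijective (P : params) (w : wave_point) :
  b1 P <> 0 -> c P <> 0 -> wave_manifold P w ->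
  exists! p, chart P p = w.
Proof.
intros Hb Hc [H HX].
set (z := wz w).
assert (Hz : z ^ 2 + 1 <> 0) by nra.
assert (HD : (z ^ 2 - 1) ^ 2 + z ^ 2 <> 0) by nra.
set (t := ((z ^ 2 - 1) * (wUt P w - 2 * c P * z / (z ^ 2 + 1))
           + z * (wV1 P w - c P / (z ^ 2 + 1)))
          / (c P * ((z ^ 2 - 1) ^ 2 + z ^ 2))).
exists (z, t, wY w); split.
- assert (HU : Ut P z t = wUt P w).
  { apply Rminus_diag_uniq. unfold Ut, t.
    replace (_ - _) with
      (z * ((z ^ 2 - 1) * wV1 P w - z * wUt P w + c P)
       / ((z ^ 2 - 1) ^ 2 + z ^ 2)) by (field; auto).
    fold z in H; rewrite H; field; auto. }
  assert (HV : V1 P z t = wV1 P w).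
  { apply Rminus_diag_uniq. unfold V1, t.
    replace (_ - _) with
      (- (z ^ 2 - 1) * ((z ^ 2 - 1) * wV1 P w - z * wUt P w + c P)
       / ((z ^ 2 - 1) ^ 2 + z ^ 2)) by (field; auto).
    fold z in H; rewrite H; field; auto. }
  unfold chart; rewrite HU, HV; fold z in HX; rewrite <- HX.
  destruct w as [z' u v u' v'].
  unfold wUt, wV1, wU, wV, wX, wY in *; simpl in *.
  f_equal; field; exact Hb.
- intros [[z' t'] Y'] E.
  destruct (chart_coordinates P z' t' Y' Hb) as [EU [EV [_ EY]]].
  rewrite E in EU, EV, EY.
  assert (Ez : z' = z) by (unfold z; rewrite <- E; reflexivity).
  subst z'. rewrite EY.
  assert (t = t') as ->; [|reflexivity].
  unfold t; rewrite EU, EV; unfold Ut, V1; field; auto.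
Qed.

Lemma hugoniot_curve_invariants (P : params) (u0 v0 z t Y : R) :
  b1 P <> 0 ->
  (hugoniot_curve P u0 v0 (z, t, Y) <->
   Ut P z t + b1 P / 2 * (z * Y) = b1 P * u0 + a1 P - a4 P /\
   V1 P z t + 1 / 2 * Y = v0 + a3 P).
Proof.
intros Hb; unfold hugoniot_curve, chart; simpl.
split; intros [H1 H2]; (split; [|lra]).
- rewrite <- H1; field; exact Hb.
- apply (Rmult_eq_reg_l (b1 P)); [|exact Hb].
  match goal with |- ?l = _ =>
    replace l with (Ut P z t - a1 P + a4 P + b1 P / 2 * (z * Y))
      by (field; exact Hb) end.
  lra.
Qed.

Lemma shock_speed_rankine_hugoniot (P : params) (p : R * R * R) :
  b1 P <> 0 ->
  let w := chart P p in
  rankine_hugoniot P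
    (shock_speed P p + (a4 P + (a4 P - a1 P) / b1 P))
    (wu w, wv w) (wu' w, wv' w).
Proof.
destruct p as [[z t] Y], P as [b d1 d2 d3 d4]; simpl; intros Hb.
unfold rankine_hugoniot, shock_speed, chart, Ut, V1, c; simpl.
split; field; split; nra.
Qed.

Lemma shock_speedE (P : params) (z t Y : R) :
  b1 P <> 0 ->
  shock_speed P (z, t, Y) =
  c P * ((b1 P + 1) * t * z ^ 4 + b1 P * t * z ^ 2 + (b1 P + 2) * z - t)
  / (b1 P * (z ^ 2 + 1)).
Proof.
intros Hb; unfold shock_speed, Ut, V1; field; split; nra.
Qed.

(* Main.v *)
Require Import Defs.
From Stdlib Require Import Reals Lra Psatz.
Open Scope R_scope.

(** On the characteristic surface [Y = 0] a Hugoniot curve fixes the pair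
    [(Ut, V1) = (U, V)], and the equation of the wave manifold then says that
    [z] is a root of the quadratic [q(x) = V x^2 - U x + (c - V)].  In the
    coordinates [(z, t)] the derivative of this quadratic at its root [z] is
    [q'(z) = c t (z^2 + 1)] ([char_quadratic_slope]), so the sign of [t] is the
    sign of the slope of [q] at the root, and [t] is determined by [z].  The two
    intersection points therefore have distinct [z], and [q] is a genuine
    quadratic: [V = 0] would force [U = 0] and then [c = 0].  Its slopes at
    the two roots are [V (z0 - z1)] and [V (z1 - z0)], which are nonzero and
    opposite, so one point is slow and the other fast.  Since [s = U / b1 + z V],
    the difference [s0 - s1] of the speeds is [V (z0 - z1)] too, that is, the
    slope at [z0]; it is negative exactly when the point over [z0] is slow. *)

(** The defining equation [(z^2 - 1) V1 - z Ut + c = 0] of the wave manifold,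
    read as a quadratic in [z] for given [Ut] and [V1]. *)
Lemma char_quadratic_root (P : params) (z t : R) :
  V1 P z t * z ^ 2 + - Ut P z t * z + (c P - V1 P z t) = 0.
Proof. unfold Ut, V1; field; nra. Qed.

(** The left side is the derivative at [z] of the quadratic of
    [char_quadratic_root]: [t] measures how far [z] is from being a double
    root. *)
Lemma char_quadratic_slope (P : params) (z t : R) :
  2 * V1 P z t * z + - Ut P z t = c P * t * (z ^ 2 + 1).
Proof. unfold Ut, V1; field; nra. Qed.

Lemma quadratic_slope_at_root (A B C x y : R) :
  A * x ^ 2 + B * x + C = 0 -> A * y ^ 2 + B * y + C = 0 -> x <> y ->
  2 * A * x + B = A * (x - y).
Proof.
intros Hx Hy Hxy.
apply (Rmult_eq_reg_r (x - y)); lra.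
Qed.

Lemma hugoniot_char_invariants (P : params) (u0 v0 z t : R) :
  b1 P <> 0 -> hugoniot_curve P u0 v0 (z, t, 0) ->
  Ut P z t = b1 P * u0 + a1 P - a4 P /\ V1 P z t = v0 + a3 P.
Proof.
intros Hb H.
apply (hugoniot_curve_invariants P u0 v0 z t 0 Hb) in H.
lra.
Qed.

Section TwoCharacteristicPoints.

Variables (P : params) (z0 t0 z1 t1 : R).
Hypothesis c_pos : 0 < c P.
Hypothesis Ut_eq : Ut P z0 t0 = Ut P z1 t1.
Hypothesis V1_eq : V1 P z0 t0 = V1 P z1 t1.

(** For equal [z] the two quadratics and their roots coincide, hence so do
    the slopes, which determine [t]. *)
Lemma t_eq_of_z_eq : z0 = z1 -> t0 = t1.
Proof.
intros Hz.
assert (H0 := char_quadratic_slope P z0 t0).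
assert (H1 := char_quadratic_slope P z1 t1).
rewrite Ut_eq, V1_eq, Hz in H0; rewrite H1 in H0.
apply (Rmult_eq_reg_r (c P * (z1 ^ 2 + 1))); nra.
Qed.

Lemma slope_eq_root_gap :
  z0 <> z1 -> c P * t0 * (z0 ^ 2 + 1) = V1 P z0 t0 * (z0 - z1).
Proof.
intros Hz.
rewrite <- char_quadratic_slope.
apply quadratic_slope_at_root with (C := c P - V1 P z0 t0); trivial.
- apply char_quadratic_root.
- rewrite Ut_eq, V1_eq; apply char_quadratic_root.
Qed.

(** If [V1] vanished, the equation at both roots would read [Ut z = c], which
    for two distinct [z] forces [Ut = 0], hence [c = 0]. *)
Lemma V1_neq0 : z0 <> z1 -> V1 P z0 t0 <> 0.
Proof.
intros Hz HV.
assert (H0 := char_quadratic_root P z0 t0).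
assert (H1 := char_quadratic_root P z1 t1).
rewrite <- Ut_eq, <- V1_eq in H1; rewrite HV in H0, H1.
assert (HU : Ut P z0 t0 = 0) by
  (apply (Rmult_eq_reg_r (z0 - z1)); lra).
rewrite HU in H0; lra.
Qed.

Lemma shock_speed_diff :
  shock_speed P (z0, t0, 0) - shock_speed P (z1, t1, 0)
  = V1 P z0 t0 * (z0 - z1).
Proof. unfold shock_speed; rewrite Ut_eq, V1_eq; ring. Qed.

End TwoCharacteristicPoints.

(** The sign of [V1 (z0 - z1)] decides which of the two points is slow, since
    it is the sign of [t0], of [- t1] and of the difference of the speeds. *)
Lemma slow_fast_of_slope_neg (P : params) (z0 t0 z1 t1 : R) :
  0 < c P -> Ut P z0 t0 = Ut P z1 t1 -> V1 P z0 t0 = V1 P z1 t1 ->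
  V1 P z0 t0 * (z0 - z1) < 0 ->
  char_slow (z0, t0, 0) /\ char_fast (z1, t1, 0) /\
  shock_speed P (z0, t0, 0) < shock_speed P (z1, t1, 0).
Proof.
intros Hc HU HV Hneg.
assert (Hz : z0 <> z1) by (intros ->; lra).
assert (S0 := slope_eq_root_gap P z0 t0 z1 t1 HU HV Hz).
assert (S1 := slope_eq_root_gap P z1 t1 z0 t0
                (eq_sym HU) (eq_sym HV) (not_eq_sym Hz)).
rewrite <- HV in S1.
assert (Hs := shock_speed_diff P z0 t0 z1 t1 HU HV).
assert (K0 : 0 < c P * (z0 ^ 2 + 1)) by nra.
assert (K1 : 0 < c P * (z1 ^ 2 + 1)) by nra.
repeat split; [| | lra].
- apply Rnot_le_lt; intros Ht; nra.
- apply Rnot_le_gt; intros Ht; nra.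
Qed.

Theorem lemma1 (P : params) (hb1 : 1 < b1 P) (hc : 0 < c P)
    (u0 v0 z0 t0 z1 t1 : R)
    (hne : (z0, t0, 0) <> (z1, t1, 0))
    (h0 : hugoniot_curve P u0 v0 (z0, t0, 0) /\ char_surface (z0, t0, 0))
    (h1 : hugoniot_curve P u0 v0 (z1, t1, 0) /\ char_surface (z1, t1, 0)) :
  (char_slow (z0, t0, 0) /\ char_fast (z1, t1, 0) /\
   shock_speed P (z0, t0, 0) < shock_speed P (z1, t1, 0)) \/
  (char_slow (z1, t1, 0) /\ char_fast (z0, t0, 0) /\
   shock_speed P (z1, t1, 0) < shock_speed P (z0, t0, 0)).
Proof.
assert (Hb : b1 P <> 0) by lra.
destruct (hugoniot_char_invariants P u0 v0 z0 t0 Hb (proj1 h0)) as [U0 W0].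
destruct (hugoniot_char_invariants P u0 v0 z1 t1 Hb (proj1 h1)) as [U1 W1].
assert (HU : Ut P z0 t0 = Ut P z1 t1) by lra.
assert (HV : V1 P z0 t0 = V1 P z1 t1) by lra.
assert (Hz : z0 <> z1).
{ intros Hz; apply hne.
  now rewrite (t_eq_of_z_eq P z0 t0 z1 t1 hc HU HV Hz), Hz. }
assert (HV0 := V1_neq0 P z0 t0 z1 t1 hc HU HV Hz).
assert (Hgap : V1 P z0 t0 * (z0 - z1) <> 0)
  by (apply Rmult_integral_contrapositive; split; lra).
destruct (Rdichotomy _ _ Hgap) as [Hneg | Hpos].
- left; apply slow_fast_of_slope_neg; assumption.
- right; apply slow_fast_of_slope_neg; auto; rewrite <- HV; lra.
Qed.
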